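(* Let $V$ and $W$ be arbitrary finite-dimensional real normed spaces with $d_{GH}(V,W)<\infty$. Then $V$ and $W$ are isometric.
   Context: A normed space is regarded as a metric space with the metric induced by its norm; two metric spaces are isometric if there is a bijective distance-preserving map between them. For a subset $A$ of a metric space $Z$ and $r>0$, let $U_r(A)=\bigcup_{a\in A}\{z\in Z : |az|<r\}$, where $|az|$ is the distance between $a$ and $z$. The Hausdorff distance between non-empty subsets $A,B\subset Z$ is $d_H(A,B)=\inf\{r>0 : A\subset U_r(B),\ B\subset U_r(A)\}$ (with $\inf\emptyset=\infty$). The Gromov--Hausdorff distance $d_{GH}(X,Y)\in[0,\infty]$ between two arbitrary (not necessarily bounded) non-empty metric spaces $X,Y$ is the infimum of positive numbers $r$ such that there exist a metric space $Z$ and subsets $X',Y'\subset Z$ with $X'$ isometric to $X$, $Y'$ isometric to $Y$, and $d_H(X',Y')\leqslant r$ (with $\inf\emptyset=\infty$). *)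

(* Defs.v *)
From HB Require Import structures.
From mathcomp Require Import all_boot all_order all_algebra.
From mathcomp Require Import all_classical all_reals all_analysis.

Set Implicit Arguments.
Unset Strict Implicit.
Unset Printing Implicit Defensive.

Import Order.TTheory GRing.Theory Num.Theory.
Import numFieldNormedType.Exports.

Local Open Scope classical_set_scope.
Local Open Scope ring_scope.

#[short(type="normedVectType")]
HB.structure Definition NormedVector (R : realType) :=
  {V of NormedModule R V & Vector R V}.

(* The library declares no metricType structure on an arbitrary normed module,
   so the metric induced by the norm is attached to an alias of the carrier;
   its topology and balls are those of V. *)
Definition norm_metric (R : realType) (V : normedModType R) : Type := V.

Section NormMetric.
Context {R : realType} (V : normedModType R).

HB.instance Definition _ := PseudoMetric.copy (norm_metric V) V.

Let dist (x y : norm_metric V) : R := `|(x : V) - (y : V)|.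

Let dist_ge0 x y : 0 <= dist x y.
Proof. exact: normr_ge0. Qed.

Let dist_positivity x y : dist x y = 0 -> x = y.
Proof. by move/normr0_eq0/eqP; rewrite subr_eq0 => /eqP. Qed.

Let ballEdist x d : ball x d = [set y | dist x y < d].
Proof. by apply/seteqP; split => y; rewrite -(@ball_normE R V). Qed.

HB.instance Definition _ := @PseudoMetric_isMetric.Build R (norm_metric V)
  dist dist_ge0 dist_positivity ballEdist.

End NormMetric.

Section GromovHausdorff.
Context {R : realType}.

Definition isometry (X Y : metricType R) (f : X -> Y) : Prop :=
  forall x y, mdist (f x) (f y) = mdist x y.

Definition isometric (X Y : metricType R) : Prop :=
  exists2 f : X -> Y, bijective f & isometry f.

(* The subset A carries the restriction of the distance of Z. *)
Definition isometric_to_subset (X Z : metricType R) (A : set Z) : Prop :=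
  exists2 f : X -> Z, set_bij [set: X] A f & isometry f.

Definition neighborhood (Z : metricType R) (r : R) (A : set Z) : set Z :=
  \bigcup_(a in A) [set z | mdist a z < r].

(* ereal_inf set0 = +oo. *)
Definition hausdorff_dist (Z : metricType R) (A B : set Z) : \bar R :=
  ereal_inf [set r%:E | r in [set r : R |
    [/\ 0 < r, A `<=` neighborhood r B & B `<=` neighborhood r A]]].

Definition gromov_hausdorff_dist (X Y : metricType R) : \bar R :=
  ereal_inf [set r%:E | r in [set r : R | 0 < r /\
    exists (Z : metricType R) (X' Y' : set Z),
      [/\ isometric_to_subset X X', isometric_to_subset Y Y' &
          (hausdorff_dist X' Y' <= r%:E)%E]]].

End GromovHausdorff.

(* Main.v *)
Require Import Defs.
From mathcomp Require Import all_boot all_order all_algebra.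
From mathcomp Require Import all_classical all_reals all_analysis.
From mathcomp Require Import lra.

(* A finite Gromov-Hausdorff distance yields a correspondence between V and W
   that distorts distances by a bounded amount.  Rescaling it by 1/n and letting
   n tend to infinity along an ultrafilter kills the distortion: boundedness in
   finite dimension makes all limits exist.  The limits f : V -> W and
   g : W -> V satisfy |x - g w| = |f x - w|, so they are mutually inverse
   isometries. *)

Set Implicit Arguments.
Unset Strict Implicit.
Unset Printing Implicit Defensive.

Import Order.TTheory GRing.Theory Num.Theory.
Import numFieldNormedType.Exports.

Local Open Scope classical_set_scope.
Local Open Scope ring_scope.

(** For each [A], the ultrafilter [F] contains the preimage of [A] or of its complement. The latter
    is excluded when a proper filter [G] finer than the image contains [A], since [G] would then
    contain two disjoint sets. *)
Lemma ultra_fmap (T U : Type) (f : T -> U) (F : set_system T) :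
  UltraFilter F -> UltraFilter (f @ F).
Proof.
move=> FU; have FF := @ultra_proper _ _ FU.
split; first exact: fmap_proper_filter.
move=> G GF sFG; apply/seteqP; split => // A GA.
have [//|FnA] := in_ultra_setVsetC (f @^-1` A) FU.
have GnA : G (~` A) by exact: sFG.
by have [x []] := filter_ex (filterI GA GnA).
Qed.

Section FiniteDimension.
Context {R : realType} (V : normedVectType R).
Import VectorInternalTheory.

Lemma r2v_continuous : continuous (r2v : 'rV[R]_(dim V) -> V).
Proof.
have -> : (r2v : 'rV[R]_(dim V) -> V) =
    (fun u => \sum_(i < dim V) u ord0 i *: r2v (delta_mx 0 i)).
  apply/funext => u; rewrite {1}[u]row_sum_delta linear_sum.
  by apply: eq_bigr => i _; rewrite linearZ.
apply: continuous_big; first exact: add_continuous.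
move=> i _ u; apply: (@cvgZr_tmp _ _ _ (nbhs u)); exact: coord_continuous.
Qed.

(** One half of the equivalence of norms: [c] is the minimum of the norm of [r2v u] over the compact
    unit sphere, positive because [r2v] is injective, and homogeneity gives the other [u]. *)
Lemma norm_r2v_ge :
  exists2 c : R, 0 < c & forall u : 'rV[R]_(dim V), c * `|u| <= `|r2v u : V|.
Proof.
pose S := [set u : 'rV[R]_(dim V) | `|u| = 1].
(* The sphere is empty when the dimension is 0; the only vector is then 0 and any constant works. *)
have [S0|] := eqVneq S set0.
  exists 1 => // u; suff -> : u = 0 by rewrite normr0 mulr0.
  apply/eqP/negPn/negP => u0.
  suff : S (`|u|^-1 *: u) by rewrite S0.
  by rewrite /S/= normrZ normfV normr_id mulVf// normr_eq0.
move=> /set0P Sn0.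
have cS : compact S.
  apply: bounded_closed_compact.
    by exists 1; split=> // M M1 u /= ->; exact: ltW.
  have /continuous_closedP normC := @norm_continuous R 'rV[R]_(dim V).
  exact: normC _ (@closed_eq _ 1%R).
have cn : {within S, continuous (fun u => `|r2v u : V|)}.
  apply: continuous_subspaceT => u.
  by apply: continuous_comp; [exact: r2v_continuous|exact: norm_continuous].
have [u0 Su0 minu0] := compact_EVT_min Sn0 cS cn.
rewrite inE /S/= in Su0.
exists `|r2v u0 : V|.
  rewrite normr_gt0; apply/eqP => ru0.
  have : u0 = 0 by rewrite -[u0]r2vK ru0 linear0.
  by move=> u00; move: Su0; rewrite u00 normr0 => /esym/eqP; rewrite oner_eq0.
move=> u; have [->|u0'] := eqVneq u 0; first by rewrite normr0 mulr0.
have nu : 0 < `|u| by rewrite normr_gt0.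
have := minu0 (`|u|^-1 *: u).
rewrite inE /S/= normrZ normfV normr_id mulVf ?gt_eqF// => /(_ erefl).
by rewrite linearZ/= normrZ normfV normr_id mulrC ler_pdivlMr.
Qed.

Lemma closed_ball_within_compact (M : R) :
  exists2 K : set V, compact K & [set x : V | `|x| <= M] `<=` K.
Proof.
have [c c0 cle] := norm_r2v_ge.
exists (r2v @` [set u : 'rV[R]_(dim V) | `|u| <= M / c]).
  apply: continuous_compact.
    by apply: continuous_subspaceT; exact: r2v_continuous.
  apply: bounded_closed_compact.
    exists (M / c); split; rewrite ?num_real// => N MN u /= uM.
    exact: le_trans uM (ltW MN).
  have /continuous_closedP normC := @norm_continuous R 'rV[R]_(dim V).
  exact: normC _ (@closed_le _ (M / c)).
move=> x /= xM; exists (v2r x); last exact: v2rK.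
rewrite /= ler_pdivlMr// mulrC; apply: le_trans (cle _) _.
by rewrite v2rK.
Qed.

(** The image of [F] under [u] is an ultrafilter containing a compact set, so it converges. *)
Lemma bounded_cvg_ultra (T : Type) (F : set_system T) (u : T -> V) (M : R) :
  UltraFilter F -> (forall t, `|u t| <= M) -> exists l : V, u @ F --> l.
Proof.
move=> FU uM; have FF := @ultra_proper _ _ FU.
have [K + sK] := closed_ball_within_compact M.
rewrite compact_ultra => /(_ _ (ultra_fmap u FU)) [|l [_ ul]]; last by exists l.
by apply: (@filterE _ F) => t; apply: sK; exact: uM.
Qed.

End FiniteDimension.

Section Rescaling.
Context {R : realType}.

Definition rescale (V : normedModType R) (u : nat -> V) : nat -> V :=
  fun n => n.+1%:R^-1 *: u n.

Lemma rescale_dist (V : normedModType R) (u v : nat -> V) n :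
  `|rescale u n - rescale v n| = n.+1%:R^-1 * `|u n - v n|.
Proof. by rewrite /rescale -scalerBr normrZ gtr0_norm. Qed.

(** Division by [n.+1] turns linear growth at rate [r] into a uniform bound. The absolute value
    makes the additive constant nonnegative, so that dividing it by [n.+1] cannot increase it. *)
Lemma rescale_le (V : normedModType R) (u : nat -> V) (v : V) (r K : R) :
  (forall n, `|u n - v| - n.+1%:R * r <= K) ->
  forall n, `|rescale u n| <= r + (`|K| + `|v|).
Proof.
move=> uv n; rewrite /rescale normrZ gtr0_norm// ler_pdivrMl//.
have uvn := uv n; have un := ler_normD (u n - v) v; rewrite subrK in un.
rewrite mulrDr; have : `|K| + `|v| <= n.+1%:R * (`|K| + `|v|).
  by rewrite ler_peMl// ?addr_ge0// ler1n.
have := ler_norm K; lra.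
Qed.

Lemma rescale_dist_lim (V W : normedModType R) (U : set_system nat)
    (a b : nat -> V) (c d : nat -> W) (K : R) (x y : V) (z t : W) :
  ProperFilter U -> \oo `<=` U ->
  (forall n, `| `|a n - b n| - `|c n - d n| | <= K) ->
  rescale a @ U --> x -> rescale b @ U --> y ->
  rescale c @ U --> z -> rescale d @ U --> t ->
  `|x - y| = `|z - t|.
Proof.
move=> UP ooU abcd ax byy cz dt; apply/eqP; rewrite -subr_eq0; apply/eqP.
pose h n := `|rescale a n - rescale b n| - `|rescale c n - rescale d n|.
have hlim : h @ U --> `|x - y| - `|z - t|.
  by apply: cvgB; apply: cvg_norm; exact: cvgB.
(* [h n] is at most [K / n.+1] in absolute value, hence tends to 0 along [\oo] and along the finer
   filter [U]. *)
have h0 : h @ U --> (0 : R).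
  apply: (@cvg_trans _ (h @ \oo)); first by move=> A; exact: ooU.
  have K0 : (fun n => n.+1%:R^-1 * K) @ \oo --> (0 : R).
    by rewrite -(mul0r K); apply: cvgMr_tmp; exact: cvg_harmonic.
  apply: norm_cvg0; apply: (squeeze_cvgr _ (cvg_cst 0) K0).
  apply: nearW => n; rewrite normr_ge0/= /h !rescale_dist -mulrBr normrM.
  by rewrite gtr0_norm// ler_pM2l.
exact: (cvg_unique _ hlim h0).
Qed.

End Rescaling.

Lemma bounded_distortion_bijection (R : realType) (V W : normedVectType R)
    (C : V -> W -> Prop) (K : R) :
  (forall x, exists w, C x w) -> (forall w, exists x, C x w) ->
  (forall x y w z, C x w -> C y z -> `| `|x - y| - `|w - z| | <= K) ->
  exists2 f : V -> W, bijective f & forall x y, `|f x - f y| = `|x - y|.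
Proof.
move=> /choice[p Cp] /choice[q Cq] CK.
(* A single ultrafilter serves all points at once, with no choice of subsequences. *)
have [U [UU ooU]] := @ultraFilterLemma _ \oo _.
have UP := @ultra_proper _ _ UU.
have lim_p x : exists l : W, rescale (fun n => p (n.+1%:R *: x)) @ U --> l.
  apply: (@bounded_cvg_ultra _ _ _ U _ (`|x| + (`|K| + `|p 0|))) => n.
  apply: rescale_le => k.
  (* Comparison with the pair [(0, p 0)] gives growth at rate [|x|], up to [K]. *)
  have := CK _ _ _ _ (Cp (k.+1%:R *: x)) (Cp 0).
  by rewrite subr0 normrZ normr_nat distrC; apply: le_trans; exact: ler_norm.
have lim_q w : exists l : V, rescale (fun n => q (n.+1%:R *: w)) @ U --> l.
  apply: (@bounded_cvg_ultra _ _ _ U _ (`|w| + (`|K| + `|q 0|))) => n.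
  apply: rescale_le => k.
  have := CK _ _ _ _ (Cq (k.+1%:R *: w)) (Cq 0).
  by rewrite subr0 normrZ normr_nat; apply: le_trans; exact: ler_norm.
move: lim_p lim_q => /choice[f fP] /choice[g gP].
have rescaleK (X : normedModType R) (x : X) :
    rescale (fun n => n.+1%:R *: x) @ U --> x.
  have -> : rescale (fun n => n.+1%:R *: x) = cst x.
    by apply/funext => n; rewrite /rescale scalerA mulVf// scale1r.
  exact: cvg_cst.
(* Compare the pairs [(n.+1 x, p (n.+1 x))] and [(q (n.+1 w), n.+1 w)] of [C], then rescale. Taking
   [w = f x] or [x = g w] makes one side vanish. *)
have fg x w : `|x - g w| = `|f x - w|.
  exact: (rescale_dist_lim UP ooU
    (fun n => CK _ _ _ _ (Cp _) (Cq _))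
    (rescaleK _ _) (gP w) (fP x) (rescaleK _ _)).
exists f.
  exists g => [x|w]; apply/eqP; rewrite -subr_eq0 -normr_eq0.
    by rewrite distrC fg subrr normr0.
  by rewrite -fg subrr normr0.
move=> x y; apply/esym.
exact: (rescale_dist_lim UP ooU
    (fun n => CK _ _ _ _ (Cp _) (Cp _))
    (rescaleK _ _) (rescaleK _ _) (fP x) (fP y)).
Qed.

Lemma hausdorff_dist_lt_pinfty (R : realType) (Z : metricType R) (A B : set Z) :
  (hausdorff_dist A B < +oo)%E -> exists r : R,
    [/\ 0 < r, A `<=` neighborhood r B & B `<=` neighborhood r A].
Proof. by move=> /ereal_inf_lt[_ [r rP _]] _; exists r. Qed.

Lemma mdist_quadrilateral (R : realType) (Z : metricType R) (a b c d : Z) :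
  `|mdist a b - mdist c d| <= mdist a c + mdist b d.
Proof.
have ac_bd := metric_triangle a c d; have ab := metric_triangle a d b.
have ca := metric_triangle c a b; have cd := metric_triangle c b d.
have [hca hdb] := (metric_sym c a, metric_sym d b).
rewrite ler_norml; apply/andP; split; lra.
Qed.

Theorem theorem8 (R : realType) (V W : normedVectType R) :
  (gromov_hausdorff_dist (norm_metric V) (norm_metric W) < +oo)%E ->
  isometric (norm_metric V) (norm_metric W).
Proof.
move=> /ereal_inf_lt[_ [r [_ [Z [X [Y [VX WY XY]]]]] <-] _].
move: VX WY => [f fbij fiso] [g gbij giso].
(* The bound [r] on an infimum need not itself be an admissible radius, so some admissible [s] is
   chosen. *)
have [s [_ XsY YsX]] := hausdorff_dist_lt_pinfty (le_lt_trans XY (ltry r)).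
(* Related points lie within [s] of each other in [Z], so two related pairs have distances differing
   by at most [s + s]. *)
pose C (x : V) (w : W) := mdist (f x) (g w) < s.
have [| | |h hbij hiso] := @bounded_distortion_bijection R V W C (s + s).
- move=> x; have [z Yz dzx] := XsY (f x) (set_bij_homo fbij (I : setT _)).
  have [w _ gw] := set_bij_surj gbij Yz; exists w.
  by rewrite /C gw metric_sym.
- move=> w; have [z Xz dzw] := YsX (g w) (set_bij_homo gbij (I : setT _)).
  by have [x _ fx] := set_bij_surj fbij Xz; exists x; rewrite /C fx.
- move=> x y w z xw yz.
  have -> : `|x - y| = mdist (f x) (f y) by rewrite fiso.
  have -> : `|w - z| = mdist (g w) (g z) by rewrite giso.
  by apply: le_trans (mdist_quadrilateral _ _ _ _) _; rewrite ltW// ltrD.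
by exists h.
Qed.
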